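(* Let $a,b>0$ be real numbers with $a^{2}+b^{2}<4$. Define $$C(a,b)=-\frac{16}{b}\int_{2}^{2+b}\frac{dw}{w(w+a)\sqrt{w^{2}+b^{2}-4}}\,\operatorname{artanh}\left(\frac{w^{2}-4-2b}{w\sqrt{w^{2}+b^{2}-4}}\right)-\frac{16}{b}\int_{2+b}^{\infty}\frac{dw}{w(w+a)\sqrt{w^{2}+b^{2}-4}}\,\operatorname{artanh}\left(\frac{b}{\sqrt{w^{2}+b^{2}-4}}\right),$$ and put $$d=\sqrt{4-a^2-b^2},\quad \phi=\arctan\left(\frac{d}{a+b+2}\right),\quad \phi_a=\arctan\left(\frac{d}{a}\right),\quad \phi_b=\arctan\left(\frac{d}{b}\right).$$ Then $$C(a,b)=\frac{8}{ab\sqrt{4-a^{2}-b^{2}}}\Big\{Cl_{2}(4\phi)+Cl_{2}(2\phi_{a}+2\phi_{b}-2\phi)+Cl_{2}(2\phi_{a}-2\phi)+Cl_{2}(2\phi_{b}-2\phi)$$ $$-Cl_{2}(2\phi_{a}+2\phi_{b}-4\phi)-Cl_{2}(2\phi_{a})-Cl_{2}(2\phi_{b})-Cl_{2}(2\phi)\Big\}.$$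
   Context: $Cl_2$ denotes the Clausen function on $\mathbb{R}$: $Cl_{2}(x)=-\int_{0}^{x}\log\left(2\left|\sin\frac{\varphi}{2}\right|\right)d\varphi=\sum_{n=1}^{\infty}\frac{\sin(nx)}{n^{2}}$. $\operatorname{artanh}(x)=\frac12\log\frac{1+x}{1-x}$ is the inverse hyperbolic tangent (for $-1<x<1$), and $\arctan$ takes values in $(-\pi/2,\pi/2)$. The first integrand has an integrable logarithmic singularity at $w=2$. *)

(* Defs.v *)
(* Classical real numbers of the Stdlib, with Coquelicot's series and
   (improper) Riemann integrals. *)
From Stdlib Require Import Reals.
From Coquelicot Require Import Coquelicot.

Open Scope R_scope.

(* The series is absolutely convergent for every real x; Series sums from
   index 0, hence the shift S n. *)
Definition Cl2 (x : R) : R :=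
  Series (fun n : nat => sin (INR (S n) * x) / INR (S n) ^ 2).

(* Meaningful for -1 < x < 1. *)
Definition artanh (x : R) : R := / 2 * ln ((1 + x) / (1 - x)).

Definition integrand1 (a b w : R) : R :=
  1 / (w * (w + a) * sqrt (w ^ 2 + b ^ 2 - 4))
  * artanh ((w ^ 2 - 4 - 2 * b) / (w * sqrt (w ^ 2 + b ^ 2 - 4))).

Definition integrand2 (a b w : R) : R :=
  1 / (w * (w + a) * sqrt (w ^ 2 + b ^ 2 - 4))
  * artanh (b / sqrt (w ^ 2 + b ^ 2 - 4)).

(* The argument of artanh in integrand1 tends to -1 as w -> 2+, where the
   integrand has a logarithmic singularity: the first integral is improper
   at its lower end, the second one at its upper end. *)
Definition Cfun (a b : R) : R :=
  - (16 / b)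
    * RInt_gen (integrand1 a b) (at_right 2) (at_point (2 + b))
  - 16 / b
    * RInt_gen (integrand2 a b) (at_point (2 + b)) (Rbar_locally p_infty).

(* Main.v *)
(** The partial fraction 1/(w(w+a)) = (1/a)(1/w - 1/(w+a)) writes C(a,b) as
    (16/(ab)) (G(a) - G(0)), where G(e) has the kernel 1/(s(w+e)) with
    s = sqrt(w^2+b^2-4).  Under w + s + e = d / tan t, d = sqrt(4-e^2-b^2), the
    measure dw/(s(w+e)) becomes -(2/d) dt, and both inverse hyperbolic tangents
    become half the logarithm of a quotient of products of sines of shifts of t,
    so that primitives are combinations of values of Cl_2.  The contribution of
    the splitting point w = 2+b is removed by a functional equation of Cl_2
    ([Cl2_identity]), and G(0) = 0 by the symmetry of Cl_2. *)
Require Import Defs.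
From Stdlib Require Import Reals Lra Lia Ranalysis5.
From Coquelicot Require Import Coquelicot.
Open Scope R_scope.

(** * The Clausen function *)

(** The substitution has two stages. Euler's u = w + s rationalises s, since u (w - s) = 4 - b^2; it
    gives dw/s = du/u and w + e = ((u + e)^2 + d^2) / (2 u), so the measure is 2 du / ((u + e)^2 +
    d^2), which u + e = d cot t makes constant. The quotients (1 + x)/(1 - x) under the two
    logarithms are, up to constants, quotients of products of u, u - b - 2, u + b + 2, u + b - 2 and
    u + 2 - b. A factor u - u0 is proportional to sin (x - t) / sin t, where cot x = (u0 + e) / d:
    the roots 0, b + 2, -(b + 2), 2 - b, b - 2 give x = A, p, p - B, A - p, A + B - p, with A, B, p
    the angles phi_a, phi_b, phi at a = e. The obstacle is the angle at w = 2 + b, which is known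
    only through a trigonometric relation with A and p, so its Clausen values cannot be simplified
    one by one. *)

Lemma Rabs_increment_le_pow (g dg : R -> R) (K : R) (n : nat) :
  (forall r, 0 <= r <= 1 -> is_derive g r (dg r)) ->
  (forall r, 0 <= r <= 1 -> Rabs (dg r) <= K * r ^ n) ->
  Rabs (g 1 - g 0) <= K / INR (S n).
Proof.
  intros Dg Bg.
  assert (Hn : 0 < INR (S n)) by (apply lt_0_INR; lia).
  assert (Dp : forall r, is_derive (fun r => K / INR (S n) * r ^ S n) r (K * r ^ n)).
  { intros r; auto_derive; [easy|].
    change (Nat.pred (S n)) with n; field.
    exact (Rgt_not_eq _ _ Hn). }
  (* The mean value theorem is applied to the majorant minus [s * g], whose derivative is
     nonnegative, for both signs [s]. Applied to [g] alone it would lose the factor 1/(n+1). *)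
  assert (Hsgn : forall s, Rabs s = 1 -> s * (g 1 - g 0) <= K / INR (S n)).
  { intros s Hs.
    destruct (MVT_gen (fun r => K / INR (S n) * r ^ S n - s * g r) 0 1
                (fun r => K * r ^ n - s * dg r)) as [c [Hc Heq]].
    - rewrite Rmin_left, Rmax_right by lra; intros r Hr.
      apply @is_derive_minus; [apply Dp|].
      apply @is_derive_scal; apply Dg; lra.
    - rewrite Rmin_left, Rmax_right by lra; intros r Hr.
      apply derivable_continuous_pt; exists (K * r ^ n - s * dg r).
      apply is_derive_Reals, @is_derive_minus; [apply Dp|].
      apply @is_derive_scal; apply Dg; lra.
    - rewrite Rmin_left, Rmax_right in Hc by lra.
      specialize (Bg c Hc).
      assert (s * dg c <= K * c ^ n).
      { apply Rle_trans with (Rabs (s * dg c)); [apply Rle_abs|].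
        rewrite Rabs_mult, Hs; lra. }
      rewrite pow1, pow_i in Heq by lia. lra. }
  apply Rabs_le; split.
  - generalize (Hsgn (-1) ltac:(rewrite Rabs_left; lra)); lra.
  - generalize (Hsgn 1 Rabs_R1); lra.
Qed.

(** Real part of a finite geometric sum of ratio r e^(ix), multiplied by |1 - r e^(ix)|^2. The
    induction needs only the three-term recurrence of the cosine. *)
Lemma cos_sum_pow (r x : R) (n : nat) :
  (1 - 2 * r * cos x + r ^ 2) * sum_n (fun k => r ^ k * cos (INR (S k) * x)) n =
  cos x - r - r ^ S n * (cos (INR (S (S n)) * x) - r * cos (INR (S n) * x)).
Proof.
  assert (Hrec : forall t, cos (t + x + x) = 2 * cos x * cos (t + x) - cos t).
  { intros t. replace (cos t) with (cos (t + x - x)) by (f_equal; ring).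
    rewrite cos_plus, cos_minus; ring. }
  induction n as [|n IH].
  - rewrite sum_O.
    replace (INR 1 * x) with (0 + x) by (simpl; ring).
    replace (INR 2 * x) with (0 + x + x) by (simpl; ring).
    rewrite Hrec, cos_0, Rplus_0_l; ring.
  - rewrite sum_Sn; change (@plus _) with Rplus.
    rewrite Rmult_plus_distr_l, IH.
    replace (INR (S (S (S n))) * x) with (INR (S n) * x + x + x)
      by (rewrite !S_INR; ring).
    replace (INR (S (S n)) * x) with (INR (S n) * x + x) by (rewrite !S_INR; ring).
    rewrite Hrec; simpl pow; ring.
Qed.

(** With s and c the sine and cosine of x/2, the quadratic equals (1 + r)^2 s^2 + (1 - r)^2 c^2. The
    bound is uniform in r, up to and including r = 1. *)
Lemma quadratic_ge_sin_half (r x : R) :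
  0 <= r -> sin (x / 2) ^ 2 <= 1 - 2 * r * cos x + r ^ 2.
Proof.
  intros Hr.
  replace (cos x) with (1 - 2 * sin (x / 2) * sin (x / 2))
    by (rewrite <- cos_2a_sin; f_equal; field).
  generalize (sin2_cos2 (x / 2)); unfold Rsqr.
  set (s := sin (x / 2)); set (c := cos (x / 2)); intros H.
  assert (0 <= (1 - r) ^ 2 * c ^ 2) by (apply Rmult_le_pos; apply pow2_ge_0).
  assert (0 <= (2 * r + r ^ 2) * s ^ 2) by (apply Rmult_le_pos; nra).
  replace (1 - 2 * r * (1 - 2 * s * s) + r ^ 2) with
    (s ^ 2 + (1 - r) ^ 2 * c ^ 2 + (2 * r + r ^ 2) * s ^ 2
     + (1 - r) ^ 2 * (1 - (s * s + c * c))) by ring.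
  rewrite H; lra.
Qed.

(* Compares [sum r^k cos(k x)/k] with [- ln (1 - 2 r cos x + r^2) / 2] on
   [0 <= r <= 1] through their derivatives in [r]. *)
Lemma cos_sum_remainder (x : R) (n : nat) :
  0 < sin (x / 2) ->
  Rabs (sum_n (fun k => cos (INR (S k) * x) / INR (S k)) n + ln (2 * sin (x / 2)))
  <= 2 / sin (x / 2) ^ 2 / INR (S (S n)).
Proof.
  intros Hs.
  assert (HD : forall r, 0 <= r -> 0 < 1 - 2 * r * cos x + r ^ 2).
  { intros r Hr; generalize (quadratic_ge_sin_half r x Hr); nra. }
  set (g := fun r => sum_n (fun k => cos (INR (S k) * x) / INR (S k) * r ^ S k) n
                     + / 2 * ln (1 - 2 * r * cos x + r ^ 2)).
  set (dg := fun r => sum_n (fun k => r ^ k * cos (INR (S k) * x)) n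
                     + (r - cos x) / (1 - 2 * r * cos x + r ^ 2)).
  assert (Hg := Rabs_increment_le_pow g dg (2 / sin (x / 2) ^ 2) (S n)).
  assert (H0 : g 0 = 0).
  { unfold g.
    rewrite (sum_n_ext _ (fun _ => 0)) by (intros k; simpl; ring).
    rewrite sum_n_const, Rmult_0_r.
    replace (1 - 2 * 0 * cos x + 0 ^ 2) with 1 by ring; rewrite ln_1; ring. }
  assert (H1 : g 1 = sum_n (fun k => cos (INR (S k) * x) / INR (S k)) n
                     + ln (2 * sin (x / 2))).
  { unfold g; f_equal.
    - apply sum_n_ext; intros k; rewrite pow1; apply Rmult_1_r.
    - replace (1 - 2 * 1 * cos x + 1 ^ 2) with ((2 * sin (x / 2)) * (2 * sin (x / 2))).
      + rewrite ln_mult by lra; field.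
      + replace (cos x) with (1 - 2 * sin (x / 2) * sin (x / 2))
          by (rewrite <- cos_2a_sin; f_equal; field). ring. }
  rewrite H0, H1, Rminus_0_r in Hg; apply Hg; clear Hg H0 H1.
  - intros r Hr; unfold g, dg.
    apply @is_derive_plus.
    + apply @is_derive_sum_n; intros k _.
      auto_derive; [easy|].
      change (match k with 0%nat => 1 | S _ => INR k + 1 end) with (INR (S k)).
      field.
      exact (not_0_INR (S k) (Nat.neq_succ_0 k)).
    + specialize (HD r (proj1 Hr)).
      auto_derive; [simpl in HD; lra|].
      field; simpl in HD; lra.
  - intros r Hr; unfold dg.
    specialize (HD r (proj1 Hr)).
    (* By [cos_sum_pow] the cosine sum and the logarithmic derivative cancel up to one term of order
       [r ^ S n], whose numerator is at most 2 and whose denominator is at least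
       [sin (x / 2) ^ 2]. *)
    replace (sum_n _ n + _) with
      (- (r ^ S n * ((cos (INR (S (S n)) * x) - r * cos (INR (S n) * x)) /
                     (1 - 2 * r * cos x + r ^ 2)))).
    2:{ assert (E := cos_sum_pow r x n).
        apply Rmult_eq_reg_l with (1 - 2 * r * cos x + r ^ 2); [|lra].
        rewrite Rmult_plus_distr_l, E; field; lra. }
    rewrite Rabs_Ropp, Rabs_mult, (Rabs_pos_eq (r ^ S n)) by (apply pow_le; lra).
    rewrite Rmult_comm; apply Rmult_le_compat_r; [apply pow_le; lra|].
    unfold Rdiv; rewrite Rabs_mult, Rabs_inv, (Rabs_pos_eq (1 - 2 * r * cos x + r ^ 2)) by lra.
    apply Rmult_le_compat.
    + apply Rabs_pos.
    + left; apply Rinv_0_lt_compat; lra.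
    + generalize (COS_bound (INR (S (S n)) * x)) (COS_bound (INR (S n) * x)); intros.
      apply Rabs_le; nra.
    + apply Rinv_le_contravar; [apply pow_lt; lra|].
      apply quadratic_ge_sin_half; lra.
Qed.

(** A telescoping majorant of the inverse squares: the partial sums are [2 - 2 / INR (S (S n))]. *)
Lemma ex_series_inv_sqr : ex_series (fun n => 2 / (INR (S n) * INR (S (S n)))).
Proof.
  exists 2.
  change (is_lim_seq (sum_n (fun n => 2 / (INR (S n) * INR (S (S n))))) 2).
  apply (is_lim_seq_ext (fun n => 2 - 2 / INR (S (S n)))).
  - induction n as [|n IH].
    + rewrite sum_O; simpl; field.
    + rewrite sum_Sn, <- IH. change (@plus _) with Rplus.
      assert (0 <= INR n) by apply pos_INR.
      rewrite !S_INR; field; lra.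
  - replace (Finite 2) with (Finite (2 - 0)) by (f_equal; ring).
    apply is_lim_seq_minus'; [apply is_lim_seq_const|].
    replace (Finite 0) with (Rbar_mult 2 (Rbar_inv p_infty)) by (simpl; f_equal; ring).
    apply @is_lim_seq_scal_l, is_lim_seq_inv; [|easy].
    apply (is_lim_seq_incr_1 (fun n => INR (S n)) p_infty).
    apply (is_lim_seq_incr_1 INR p_infty), is_lim_seq_INR.
Qed.

Lemma Cl2_term_le (n : nat) (x : R) :
  Rabs (sin (INR (S n) * x) / INR (S n) ^ 2) <= 2 / (INR (S n) * INR (S (S n))).
Proof.
  assert (0 <= INR n) by apply pos_INR.
  unfold Rdiv; rewrite Rabs_mult.
  assert (Hs : Rabs (sin (INR (S n) * x)) <= 1)
    by (apply Rabs_le, SIN_bound).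
  rewrite (Rabs_pos_eq (/ _)) by
    (left; apply Rinv_0_lt_compat, pow_lt; rewrite S_INR; lra).
  apply Rle_trans with (1 * / INR (S n) ^ 2).
  - apply Rmult_le_compat_r; [|easy].
    left; apply Rinv_0_lt_compat, pow_lt; rewrite S_INR; lra.
  - replace (2 * / (INR (S n) * INR (S (S n)))) with
      (/ (INR (S n) * (INR (S (S n)) / 2))) by (rewrite !S_INR; field; lra).
    rewrite Rmult_1_l; apply Rinv_le_contravar; rewrite !S_INR; nra.
Qed.

Lemma ex_series_Cl2 (x : R) :
  ex_series (fun n => sin (INR (S n) * x) / INR (S n) ^ 2).
Proof.
  apply (@ex_series_le R_AbsRing R_CompleteNormedModule) with
    (fun n => 2 / (INR (S n) * INR (S (S n)))); [|apply ex_series_inv_sqr].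
  intros n; apply Cl2_term_le.
Qed.

(** Treated apart because the derivative of [Cl2] has a logarithmic singularity at 0. The point
    matters: [Cl2 (2 * (p - t))] reaches it at [t = p], that is at w = 2. *)
Lemma continuity_pt_Cl2_0 : continuity_pt Cl2 0.
Proof.
  set (fn := fun n x => sin (INR (S n) * x) / INR (S n) ^ 2).
  assert (HN : CVN_r fn (mkposreal 1 Rlt_0_1)).
  {
    exists (fun n => 2 / (INR (S n) * INR (S (S n)))).
    exists (Series (fun n => 2 / (INR (S n) * INR (S (S n))))).
    split.
    - apply is_lim_seq_Reals.
      generalize (Series_correct _ ex_series_inv_sqr); intros Hs.
      eapply is_lim_seq_ext; [|exact Hs].
      intros n; rewrite sum_n_Reals; apply sum_eq; intros i _.
      rewrite Rabs_pos_eq; [easy|].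
      left; apply Rdiv_lt_0_compat; [lra|].
      apply Rmult_lt_0_compat; apply lt_0_INR; lia.
    - intros n y _; apply Cl2_term_le. }
  destruct (CVN_CVU_r fn _ HN 0) as [e He]; [rewrite Rabs_R0; simpl; lra|].
  apply (CVU_continuity _ _ 0 e He).
  - intros n y _; unfold SP.
    induction n as [|n IH]; simpl sum_f_R0; unfold fn; [reg|].
    apply (continuity_pt_plus (fun x => sum_f_R0 (fun k => fn k x) n) (fun x => fn (S n) x));
      [exact IH|unfold fn; reg].
  - unfold Boule; rewrite Rminus_diag, Rabs_R0; apply cond_pos.
Qed.

(** The differentiated series of cos(kx)/k does not converge absolutely, so the Weierstrass test
    does not apply to it. Instead [cos_sum_remainder] gives uniform convergence on a ball staying at
    distance [m] from 0 and 2 PI, where sin(y/2) is at least sin(m/2). *)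
Lemma is_derive_Cl2 (x : R) :
  0 < x < 2 * PI -> is_derive Cl2 x (- ln (2 * sin (x / 2))).
Proof.
  intros Hx.
  assert (Hsx : forall y, 0 < y < 2 * PI -> 0 < sin (y / 2))
    by (intros y Hy; apply sin_gt_0; lra).
  set (m := / 2 * Rmin x (2 * PI - x)).
  assert (Hm : 0 < m /\ 2 * m <= x /\ 2 * m <= 2 * PI - x).
  { generalize (Rmin_l x (2 * PI - x)) (Rmin_r x (2 * PI - x)).
    assert (0 < Rmin x (2 * PI - x)) by (apply Rmin_glb_lt; lra).
    unfold m; lra. }
  set (r := mkposreal m (proj1 Hm)).
  assert (Hb : forall y, Boule x r y -> m <= y <= 2 * PI - m).
  { intros y Hy; apply Rabs_def2 in Hy; simpl in Hy; lra. }
  assert (Hmin : forall y, Boule x r y -> sin (m / 2) <= sin (y / 2)).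
  { intros y Hy; apply Hb in Hy.
    destruct (Rle_dec (y / 2) (PI / 2)).
    - apply sin_incr_1; lra.
    - rewrite <- (sin_PI_x (y / 2)).
      apply sin_incr_1; lra. }
  assert (Hs0 : 0 < sin (m / 2)) by (apply Hsx; generalize PI_RGT_0; lra).
  apply is_derive_Reals.
  apply derivable_pt_lim_CVU with
    (fn := fun n y => sum_n (fun k => sin (INR (S k) * y) / INR (S k) ^ 2) n)
    (fn' := fun n y => sum_n (fun k => cos (INR (S k) * y) / INR (S k)) n)
    (g := fun y => - ln (2 * sin (y / 2))) (c := x) (r := r).
  - unfold Boule; rewrite Rminus_diag, Rabs_R0; apply cond_pos.
  - intros y n _; apply is_derive_Reals, @is_derive_sum_n; intros k _.
    auto_derive; [easy|].
    change (match k with 0%nat => 1 | S _ => INR k + 1 end) with (INR (S k)).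
    field; exact (not_0_INR (S k) (Nat.neq_succ_0 k)).
  - intros y _; apply is_lim_seq_Reals.
    apply (Series_correct _ (ex_series_Cl2 y)).
  - intros eps Heps.
    set (K := 2 / sin (m / 2) ^ 2).
    assert (HK : 0 < K) by (apply Rdiv_lt_0_compat; [lra|apply pow_lt; lra]).
    destruct (INR_archimed eps K Heps) as [N HN].
    exists N; intros n y Hn Hy.
    rewrite <- Rabs_Ropp.
    replace (- (- ln (2 * sin (y / 2)) - _)) with
      (sum_n (fun k => cos (INR (S k) * y) / INR (S k)) n + ln (2 * sin (y / 2))) by ring.
    assert (Hsy := Hmin y Hy).
    eapply Rle_lt_trans; [apply cos_sum_remainder; lra|].
    apply Rle_lt_trans with (K / INR (S (S n))).
    + unfold K, Rdiv; rewrite !Rmult_assoc; apply Rmult_le_compat_l; [lra|].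
      apply Rmult_le_compat_r; [left; apply Rinv_0_lt_compat, lt_0_INR; lia|].
      apply Rinv_le_contravar; [apply pow_lt; lra|apply pow_incr; lra].
    + assert (INR N <= INR n) by (apply le_INR; easy).
      apply Rmult_lt_reg_r with (INR (S (S n))); [apply lt_0_INR; lia|].
      unfold Rdiv; rewrite Rmult_assoc, Rinv_l by (apply not_0_INR; lia).
      rewrite !S_INR; nra.
  - intros y Hy.
    assert (Hsy := Hmin y Hy).
    apply derivable_continuous_pt.
    exists (- (/ (2 * sin (y / 2)) * cos (y / 2))).
    apply is_derive_Reals; auto_derive; [lra|unfold Rdiv in *; field; lra].
Qed.

Lemma Cl2_odd (x : R) : Cl2 (- x) = - Cl2 x.
Proof.
  unfold Cl2; rewrite <- Series_opp; apply Series_ext; intros n.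
  rewrite Ropp_mult_distr_r_reverse, sin_neg; unfold Rdiv; ring.
Qed.

Lemma Cl2_0 : Cl2 0 = 0.
Proof. generalize (Cl2_odd 0); rewrite Ropp_0; lra. Qed.

Lemma Cl2_2PI_minus (x : R) : Cl2 (2 * PI - x) = - Cl2 x.
Proof.
  rewrite <- Cl2_odd; unfold Cl2; apply Series_ext; intros n; f_equal.
  replace (INR (S n) * (2 * PI - x)) with (INR (S n) * - x + 2 * INR (S n) * PI) by ring.
  apply sin_period.
Qed.

Lemma Cl2_PI : Cl2 PI = 0.
Proof.
  generalize (Cl2_2PI_minus PI); replace (2 * PI - PI) with PI by ring; lra.
Qed.

(** * A functional equation of the Clausen function *)

Lemma is_derive_Cl2_comp (f : R -> R) (x l : R) :
  0 < f x < PI -> is_derive f x l ->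
  is_derive (fun t => Cl2 (2 * f t)) x (- 2 * l * ln (2 * sin (f x))).
Proof.
  intros Hf Df.
  replace (- 2 * l * ln (2 * sin (f x))) with (2 * l * - ln (2 * sin (2 * f x / 2))).
  - apply (is_derive_comp Cl2 (fun t => 2 * f t)).
    + apply is_derive_Cl2; lra.
    + apply @is_derive_scal; exact Df.
  - replace (2 * f x / 2) with (f x) by field; ring.
Qed.

Lemma continuous_Cl2_comp (f : R -> R) (x : R) :
  0 <= f x < PI -> continuous f x -> continuous (fun t => Cl2 (2 * f t)) x.
Proof.
  intros Hf Cf.
  apply (continuous_comp (fun t => 2 * f t) Cl2).
  - apply @continuous_scal_r; exact Cf.
  - destruct (Req_dec (f x) 0) as [E|E].
    + rewrite E, Rmult_0_r; apply continuity_pt_filterlim, continuity_pt_Cl2_0.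
    + apply @ex_derive_continuous.
      eexists; apply is_derive_Cl2; lra.
Qed.

Lemma is_derive_acos (x : R) :
  -1 < x < 1 -> is_derive acos x (-1 / sqrt (1 - x²)).
Proof.
  intros Hx; apply is_derive_Reals.
  rewrite <- (derive_pt_acos x Hx).
  exact (proj2_sig (derivable_pt_acos x Hx)).
Qed.

Lemma two_sin_sin (x y : R) : 2 * (sin x * sin y) = cos (x - y) - cos (x + y).
Proof. rewrite cos_minus, cos_plus; ring. Qed.

(* Differentiate in [p] with [t = (A - acos (cos (A - p) / cos p)) / 2]; the
   relation between [A], [p] and [t] makes the coefficient of [dt/dp] vanish,
   and both sides agree at [p = t = 0]. *)
Lemma Cl2_identity (A p t : R) :
  0 < p -> 2 * p < A -> A <= PI / 2 -> 0 < t < p ->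
  cos (A - 2 * t) * cos p = cos (A - p) ->
  2 * (Cl2 (2 * (A - t)) + Cl2 (2 * (p - t)) + Cl2 (2 * t)
       - Cl2 (2 * (A - p - t)))
  = Cl2 (2 * A) + 4 * Cl2 (2 * p) - Cl2 (2 * (A - 2 * p)) - Cl2 (2 * (2 * p)).
Proof.
  intros Hp HpA HA Ht Heq.
  set (X := fun q => cos (A - q) / cos q).
  set (th := fun q => (A - acos (X q)) / 2).
  assert (Hcos : forall q, 0 <= q <= p -> 0 < cos q)
    by (intros q Hq; apply cos_gt_0; lra).
  assert (HX : forall q, 0 <= q <= p -> -1 < X q < 1).
  { intros q Hq; unfold X; specialize (Hcos q Hq); split.
    - apply Rlt_le_trans with 0; [lra|].
      apply Rmult_le_pos; [apply cos_ge_0; lra|].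
      left; apply Rinv_0_lt_compat; lra.
    - apply Rmult_lt_reg_r with (cos q); [lra|].
      unfold Rdiv; rewrite Rmult_assoc, Rinv_l, Rmult_1_r, Rmult_1_l by lra.
      apply cos_decreasing_1; lra. }
  assert (Hrel : forall q, 0 <= q <= p -> cos (A - 2 * th q) * cos q = cos (A - q)).
  { intros q Hq; unfold th.
    replace (A - 2 * ((A - acos (X q)) / 2)) with (acos (X q)) by field.
    rewrite cos_acos by (specialize (HX q Hq); lra).
    unfold X; field; specialize (Hcos q Hq); lra. }
  (* Otherwise monotonicity of the cosine compares [A - 2 * th q] with [A] or with [A - 2 * q], and
     the relation [Hr] would force sin A sin q, respectively sin (A - 2q) sin q, to be nonpositive.
     These bounds keep every Clausen argument below inside the range of differentiability. *)
  assert (Hth : forall q, 0 < q <= p -> 0 < th q < q).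
  { intros q Hq.
    assert (Hpsi := acos_bound (X q)).
    assert (Hr := Hrel q ltac:(lra)).
    assert (Hc := Hcos q ltac:(lra)).
    assert (Hsq : 0 < sin q) by (apply sin_gt_0; lra).
    assert (HsA : 0 < sin A) by (apply sin_gt_0; lra).
    assert (HsAq : 0 < sin (A - 2 * q)) by (apply sin_gt_0; lra).
    replace (acos (X q)) with (A - 2 * th q) in Hpsi by (unfold th; field).
    split; apply Rnot_le_lt; intros Hn.
    - assert (H : cos (A - 2 * th q) <= cos A) by (apply cos_decr_1; lra).
      rewrite (cos_minus A q) in Hr; nra.
    - assert (H : cos (A - 2 * q) <= cos (A - 2 * th q)) by (apply cos_decr_1; lra).
      replace (A - q) with (A - 2 * q + q) in Hr by ring.
      rewrite cos_plus in Hr; nra. }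
  assert (Hth0 : th 0 = 0).
  { unfold th, X; rewrite Rminus_0_r, cos_0, Rdiv_1_r, acos_cos by lra; field. }
  assert (Hthp : th p = t).
  { unfold th, X; rewrite <- Heq.
    replace (cos (A - 2 * t) * cos p / cos p) with (cos (A - 2 * t))
      by (field; specialize (Hcos p ltac:(lra)); lra).
    rewrite acos_cos by lra; field. }
  assert (Dth : forall q, 0 <= q <= p -> exists T, is_derive th q T).
  { intros q Hq; eexists; unfold th.
    apply (is_derive_ext (fun q => / 2 * (A - acos (X q)))); [intros; apply Rmult_comm|].
    apply @is_derive_scal, @is_derive_minus; [apply @is_derive_const|].
    apply is_derive_comp; [apply is_derive_acos, HX, Hq|].
    unfold X; apply Derive_correct; auto_derive.
    specialize (Hcos q Hq); lra. }
  set (F := fun q => 2 * (Cl2 (2 * (A - th q)) + Cl2 (2 * (q - th q)) + Cl2 (2 * th q)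
       - Cl2 (2 * (A - q - th q)))
       - (Cl2 (2 * A) + 4 * Cl2 (2 * q) - Cl2 (2 * (A - 2 * q)) - Cl2 (2 * (2 * q)))).
  assert (HF0 : F 0 = 0).
  { unfold F; rewrite Hth0, !Rmult_0_r, !Rminus_0_r, Rmult_0_r, Cl2_0; ring. }
  assert (HFp : F p = F 0).
  { destruct (MVT_gen F 0 p (fun _ => 0)) as [c [_ Hc]]; [| |lra];
      rewrite Rmin_left, Rmax_right by lra; intros q Hq.
    - destruct (Dth q ltac:(lra)) as [T DT].
      assert (Bth := Hth q ltac:(lra)).
      assert (Hr := Hrel q ltac:(lra)).
      assert (S1 : 0 < sin (A - th q)) by (apply sin_gt_0; lra).
      assert (S2 : 0 < sin (q - th q)) by (apply sin_gt_0; lra).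
      assert (S3 : 0 < sin (th q)) by (apply sin_gt_0; lra).
      assert (S4 : 0 < sin (A - q - th q)) by (apply sin_gt_0; lra).
      assert (S5 : 0 < sin q) by (apply sin_gt_0; lra).
      assert (S6 : 0 < sin (A - 2 * q)) by (apply sin_gt_0; lra).
      assert (S7 : 0 < sin (2 * q)) by (apply sin_gt_0; lra).
      (* [L1] annihilates the coefficient of [T] in the derivative of [F], and [L2] annihilates what
         remains. Both are the relation [Hr] read through product-to-sum formulas. *)
      assert (L1 : ln (2 * sin (A - th q)) + ln (2 * sin (q - th q)) =
                   ln (2 * sin (th q)) + ln (2 * sin (A - q - th q))).
      { rewrite <- !ln_mult by lra; f_equal.
        generalize (two_sin_sin (A - th q) (q - th q)) (two_sin_sin (th q) (A - q - th q)).
        replace (A - th q - (q - th q)) with (A - q) by ring.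
        replace (A - th q + (q - th q)) with (A - 2 * th q + q) by ring.
        replace (th q - (A - q - th q)) with (- (A - 2 * th q - q)) by ring.
        replace (th q + (A - q - th q)) with (A - q) by ring.
        rewrite cos_neg, cos_plus, (cos_minus (A - 2 * th q) q); lra. }
      assert (L2 : ln (2 * sin (q - th q)) + ln (2 * sin (A - q - th q)) + ln (2 * sin (2 * q))
                   = 2 * ln (2 * sin q) + ln (2 * sin (A - 2 * q))).
      { replace (2 * ln (2 * sin q)) with (ln (2 * sin q) + ln (2 * sin q)) by ring.
        rewrite <- !ln_mult by (repeat apply Rmult_lt_0_compat; lra); f_equal.
        generalize (two_sin_sin (q - th q) (A - q - th q)).
        replace (q - th q - (A - q - th q)) with (- (A - 2 * q)) by ring.
        replace (q - th q + (A - q - th q)) with (A - 2 * th q) by ring.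
        replace (A - q) with (A - 2 * q + q) in Hr by ring.
        rewrite cos_plus in Hr; rewrite cos_neg, sin_2a.
        set (v := A - q - th q).
        intros E.
        replace (2 * sin (q - th q) * (2 * sin v) * (2 * (2 * sin q * cos q)))
          with (8 * sin q * (2 * (sin (q - th q) * sin v) * cos q)) by ring.
        rewrite E.
        replace ((cos (A - 2 * q) - cos (A - 2 * th q)) * cos q) with
          (cos (A - 2 * q) * cos q - cos (A - 2 * th q) * cos q) by ring.
        rewrite Hr; ring. }
      apply (is_derive_ext F); [easy|]; unfold F.
      assert (D1 := is_derive_Cl2_comp (fun q => A - th q) q (0 - T)).
      assert (D2 := is_derive_Cl2_comp (fun q => q - th q) q (1 - T)).
      assert (D3 := is_derive_Cl2_comp th q T ltac:(lra) DT).
      assert (D4 := is_derive_Cl2_comp (fun q => A - q - th q) q (0 - 1 - T)).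
      assert (D5 := is_derive_Cl2_comp (fun q => q) q 1 ltac:(lra)).
      assert (D6 := is_derive_Cl2_comp (fun q => A - 2 * q) q (0 - 2 * 1) ltac:(lra)).
      assert (D7 := is_derive_Cl2_comp (fun q => 2 * q) q (2 * 1) ltac:(lra)).
      simpl in D1, D2, D4, D5, D6, D7.
      evar_last.
      + apply @is_derive_minus.
        * apply @is_derive_scal, @is_derive_minus;
            [apply @is_derive_plus; [apply @is_derive_plus|]|].
          -- apply D1; [lra|].
             apply @is_derive_minus; [apply @is_derive_const|exact DT].
          -- apply D2; [lra|].
             apply @is_derive_minus; [apply @is_derive_id|exact DT].
          -- apply D3.
          -- apply D4; [lra|].
             apply @is_derive_minus; [|exact DT].
             apply @is_derive_minus; [apply @is_derive_const|apply @is_derive_id].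
        * apply @is_derive_minus; [apply @is_derive_minus; [apply @is_derive_plus|]|].
          -- apply @is_derive_const.
          -- apply @is_derive_scal, D5, @is_derive_id.
          -- apply D6, @is_derive_minus; [apply @is_derive_const|].
             apply @is_derive_scal, @is_derive_id.
          -- apply D7, @is_derive_scal, @is_derive_id.
      + unfold minus, plus, opp, zero; simpl.
        replace (ln (2 * sin (A - th q))) with
          (ln (2 * sin (th q)) + ln (2 * sin (A - q - th q)) - ln (2 * sin (q - th q))) by lra.
        replace (ln (2 * sin (A - 2 * q))) with
          (ln (2 * sin (q - th q)) + ln (2 * sin (A - q - th q)) + ln (2 * sin (2 * q))
           - 2 * ln (2 * sin q)) by lra.
        ring.
    - destruct (Dth q ltac:(lra)) as [T DT].
      assert (Cth : continuous th q) by (apply @ex_derive_continuous; now exists T).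
      assert (Bth : 0 <= th q <= q /\ (0 < q -> th q < q)).
      { destruct (Req_dec q 0) as [->|E]; [rewrite Hth0; lra|].
        specialize (Hth q ltac:(lra)); lra. }
      apply continuity_pt_filterlim.
      change (continuous F q); unfold F.
      apply @continuous_minus.
      + apply @continuous_scal_r, @continuous_minus;
          [apply @continuous_plus; [apply @continuous_plus|]|].
        * apply (continuous_Cl2_comp (fun q => A - th q)); [lra|].
          apply @continuous_minus; [apply @continuous_const|exact Cth].
        * apply (continuous_Cl2_comp (fun q => q - th q)); [lra|].
          apply @continuous_minus; [apply @continuous_id|exact Cth].
        * apply (continuous_Cl2_comp th); [lra|exact Cth].
        * apply (continuous_Cl2_comp (fun q => A - q - th q)); [lra|].
          apply @continuous_minus; [|exact Cth].
          apply @continuous_minus; [apply @continuous_const|apply @continuous_id].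
      + apply @continuous_minus; [apply @continuous_minus; [apply @continuous_plus|]|].
        * apply @continuous_const.
        * apply @continuous_scal_r, (continuous_Cl2_comp (fun q => q)); [lra|].
          apply @continuous_id.
        * apply (continuous_Cl2_comp (fun q => A - 2 * q)); [lra|].
          apply @continuous_minus; [apply @continuous_const|].
          apply @continuous_scal_r, @continuous_id.
        * apply (continuous_Cl2_comp (fun q => 2 * q)); [lra|].
          apply @continuous_scal_r, @continuous_id. }
  rewrite HF0 in HFp; unfold F in HFp; rewrite Hthp in HFp; lra.
Qed.

(** * Primitives in the angular variable *)

(** Each ln(2 sin(x - t)) has antiderivative Cl2(2(x - t))/2. The terms in [A - t] and [t] have
    weight 1 because these two sines occur squared under the logarithm. *)
Definition primitive1 (A B p t : R) : R :=
  Cl2 (2 * (A - t)) + / 2 * Cl2 (2 * (p - t)) - / 2 * Cl2 (2 * (B - p + t))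
  + Cl2 (2 * t) - / 2 * Cl2 (2 * (A - p - t)) - / 2 * Cl2 (2 * (A + B - p - t)).

Definition primitive2 (A B p t : R) : R :=
  / 2 * (Cl2 (2 * (A - p - t)) - Cl2 (2 * (B - p + t)) - Cl2 (2 * (p - t))
         - Cl2 (2 * (A + B - p - t))).

Lemma is_derive_primitive1 (A B p t : R) :
  0 < t < p -> 2 * p < A <= PI / 2 -> p < B < PI / 2 ->
  is_derive (primitive1 A B p) t
    (2 * ln (2 * sin (A - t)) + ln (2 * sin (p - t)) + ln (2 * sin (B - p + t))
     - 2 * ln (2 * sin t) - ln (2 * sin (A - p - t)) - ln (2 * sin (A + B - p - t))).
Proof.
  intros Ht HA HB; unfold primitive1.
  evar_last.
  - apply @is_derive_minus; [apply @is_derive_minus; [apply @is_derive_plus;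
      [apply @is_derive_minus; [apply @is_derive_plus|]|]|]|].
    + apply (is_derive_Cl2_comp (fun t => A - t) t (-1)); [lra|auto_derive; [easy|ring]].
    + apply @is_derive_scal.
      apply (is_derive_Cl2_comp (fun t => p - t) t (-1)); [lra|auto_derive; [easy|ring]].
    + apply @is_derive_scal.
      apply (is_derive_Cl2_comp (fun t => B - p + t) t 1); [lra|auto_derive; [easy|ring]].
    + apply (is_derive_Cl2_comp (fun t => t) t 1); [lra|auto_derive; [easy|ring]].
    + apply @is_derive_scal.
      apply (is_derive_Cl2_comp (fun t => A - p - t) t (-1)); [lra|auto_derive; [easy|ring]].
    + apply @is_derive_scal.
      apply (is_derive_Cl2_comp (fun t => A + B - p - t) t (-1)); [lra|auto_derive; [easy|ring]].
  - unfold minus, plus, opp; simpl; field.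
Qed.

(** Reaches [t = p], the image of w = 2, where the derivative blows up through ln(2 sin(p - t)). *)
Lemma continuous_primitive1 (A B p t : R) :
  0 < t <= p -> 2 * p < A <= PI / 2 -> p < B < PI / 2 ->
  continuous (primitive1 A B p) t.
Proof.
  intros Ht HA HB; unfold primitive1.
  assert (Csub : forall x, continuous (fun t : R => x - t) t)
    by (intros x; apply @continuous_minus; [apply @continuous_const|apply @continuous_id]).
  apply @continuous_minus; [apply @continuous_minus; [apply @continuous_plus;
      [apply @continuous_minus; [apply @continuous_plus|]|]|]|].
  - apply (continuous_Cl2_comp (fun t => A - t)); [lra|apply Csub].
  - apply @continuous_scal_r, (continuous_Cl2_comp (fun t => p - t)); [lra|apply Csub].
  - apply @continuous_scal_r, (continuous_Cl2_comp (fun t => B - p + t)); [lra|].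
    apply @continuous_plus; [apply @continuous_const|apply @continuous_id].
  - apply (continuous_Cl2_comp (fun t => t)); [lra|apply @continuous_id].
  - apply @continuous_scal_r, (continuous_Cl2_comp (fun t => A - p - t)); [lra|apply Csub].
  - apply @continuous_scal_r, (continuous_Cl2_comp (fun t => A + B - p - t)); [lra|apply Csub].
Qed.

(** Reaches [t = 0], the image of w = infinity, where no sine in the formula vanishes. *)
Lemma is_derive_primitive2 (A B p t : R) :
  0 <= t < p -> 2 * p < A <= PI / 2 -> p < B < PI / 2 ->
  is_derive (primitive2 A B p) t
    (ln (2 * sin (A - p - t)) + ln (2 * sin (B - p + t)) - ln (2 * sin (p - t))
     - ln (2 * sin (A + B - p - t))).
Proof.
  intros Ht HA HB; unfold primitive2.
  evar_last.
  - apply @is_derive_scal.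
    apply @is_derive_minus; [apply @is_derive_minus; [apply @is_derive_minus|]|].
    + apply (is_derive_Cl2_comp (fun t => A - p - t) t (-1)); [lra|auto_derive; [easy|ring]].
    + apply (is_derive_Cl2_comp (fun t => B - p + t) t 1); [lra|auto_derive; [easy|ring]].
    + apply (is_derive_Cl2_comp (fun t => p - t) t (-1)); [lra|auto_derive; [easy|ring]].
    + apply (is_derive_Cl2_comp (fun t => A + B - p - t) t (-1)); [lra|auto_derive; [easy|ring]].
  - unfold minus, plus, opp; simpl; field.
Qed.

Definition Cl2_sum (A B p : R) : R :=
  Cl2 (4 * p) + Cl2 (2 * A + 2 * B - 2 * p) + Cl2 (2 * A - 2 * p)
  + Cl2 (2 * B - 2 * p) - Cl2 (2 * A + 2 * B - 4 * p)
  - Cl2 (2 * A) - Cl2 (2 * B) - Cl2 (2 * p).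

(** At [t] the terms containing [B] are common to both primitives and cancel. What is left is minus
    one half of the left side of [Cl2_identity], which trades it for values free of [t]. *)
Lemma primitives_Cl2_sum (A B p t : R) :
  0 < t < p -> 2 * p < A <= PI / 2 -> cos (A - 2 * t) * cos p = cos (A - p) ->
  primitive1 A B p p - primitive1 A B p t + (primitive2 A B p t - primitive2 A B p 0)
  = / 2 * Cl2_sum A B p.
Proof.
  intros Ht HA Heq.
  assert (E := Cl2_identity A p t ltac:(lra) ltac:(lra) ltac:(lra) Ht Heq).
  unfold primitive1, primitive2, Cl2_sum.
  rewrite Rminus_diag, Rmult_0_r, Cl2_0, !Rminus_0_r, Rplus_0_r.
  replace (A - p - p) with (A - 2 * p) by ring.
  replace (B - p + p) with B by ring.
  replace (2 * A + 2 * B - 2 * p) with (2 * (A + B - p)) by ring.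
  replace (2 * A + 2 * B - 4 * p) with (2 * (A + B - p - p)) by ring.
  replace (4 * p) with (2 * (2 * p)) by ring.
  replace (2 * A - 2 * p) with (2 * (A - p)) by ring.
  replace (2 * B - 2 * p) with (2 * (B - p)) by ring.
  lra.
Qed.

(** * The angles and the trigonometric substitution *)

Definition dpar (e b : R) : R := sqrt (4 - e ^ 2 - b ^ 2).
(* Equals [atan (dpar e b / e)] for [e > 0]; in this form it is also correct,
   with value [PI / 2], at [e = 0]. *)
Definition angleA (e b : R) : R := PI / 2 - atan (e / dpar e b).
Definition angleB (e b : R) : R := atan (dpar e b / b).
Definition angleP (e b : R) : R := atan (dpar e b / (e + b + 2)).
Definition root (b w : R) : R := sqrt (w ^ 2 + b ^ 2 - 4).
(* The substitution [w + root b w + e = dpar e b / tan theta], which turns the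
   integrals into integrals of logarithms of sines. *)
Definition theta (e b w : R) : R := atan (dpar e b / (w + root b w + e)).

(** The hypotenuse [r] stays abstract, since such lengths cancel in the quotients of sines formed
    later. *)
Lemma sin_cos_atan_div (x y : R) :
  0 < x -> exists r, 0 < r /\ sin (atan (y / x)) = y / r /\ cos (atan (y / x)) = x / r
                     /\ r * r = x * x + y * y.
Proof.
  intros Hx.
  assert (H1 : 0 < 1 + (y / x)²) by (generalize (Rle_0_sqr (y / x)); lra).
  assert (Hs := sqrt_lt_R0 _ H1).
  exists (x * sqrt (1 + (y / x)²)); repeat split.
  - apply Rmult_lt_0_compat; lra.
  - rewrite sin_atan; field; lra.
  - rewrite cos_atan; field; lra.
  - replace (x * sqrt (1 + (y / x)²) * (x * sqrt (1 + (y / x)²))) with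
      (x * x * (sqrt (1 + (y / x)²) * sqrt (1 + (y / x)²))) by ring.
    rewrite sqrt_sqrt by lra; unfold Rsqr; field; lra.
Qed.

Lemma atan_bound_pos (x : R) : 0 < x -> 0 < atan x < PI / 2.
Proof.
  intros Hx; split; [|apply atan_bound].
  rewrite <- atan_0; apply atan_increasing, Hx.
Qed.

Lemma sin_pos_inv (x : R) : - PI < x -> 0 < sin x -> 0 < x.
Proof.
  intros Hx Hs; apply Rnot_le_lt; intros Hn.
  generalize (sin_ge_0 (- x)); rewrite sin_neg; lra.
Qed.

Lemma dpar_pos (e b : R) : e ^ 2 + b ^ 2 < 4 -> 0 < dpar e b.
Proof. intros H; apply sqrt_lt_R0; lra. Qed.

Lemma dpar_sqr (e b : R) :
  e ^ 2 + b ^ 2 < 4 -> dpar e b * dpar e b = 4 - e ^ 2 - b ^ 2.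
Proof. intros H; apply sqrt_sqrt; lra. Qed.

Lemma root_sqr (b w : R) : 2 <= w -> root b w * root b w = w ^ 2 + b ^ 2 - 4.
Proof. intros H; apply sqrt_sqrt; nra. Qed.

Lemma root_pos (b w : R) : 0 < b -> 2 <= w -> 0 < root b w.
Proof. intros Hb H; apply sqrt_lt_R0; nra. Qed.

Lemma root_gt (b w : R) : 0 < b -> 2 < w -> b < root b w.
Proof.
  intros Hb H; generalize (root_sqr b w ltac:(lra)) (root_pos b w Hb ltac:(lra)); nra.
Qed.

(** [c], [q], [r] are the hypotenuses over the legs e, b, e + b + 2 and d. The factorisations come
    from d^2 = 4 - e^2 - b^2, for instance b (e + b + 2) + d^2 = (e + 2) (2 - e + b). *)
Lemma angles_sin_cos (e b : R) :
  0 <= e -> 0 < b -> e ^ 2 + b ^ 2 < 4 ->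
  exists c q r, 0 < c /\ 0 < q /\ 0 < r /\
  (sin (angleA e b) = dpar e b / c /\ cos (angleA e b) = e / c) /\
  (sin (angleB e b - angleP e b) = dpar e b * (e + 2) / (q * r) /\
   cos (angleB e b - angleP e b) = (e + 2) * (2 - e + b) / (q * r)) /\
  (sin (angleP e b) = dpar e b / r /\ cos (angleP e b) = (e + b + 2) / r) /\
  (sin (angleA e b - angleP e b) = dpar e b * (b + 2) / (c * r) /\
   cos (angleA e b - angleP e b) = (b + 2) * (2 - b + e) / (c * r)) /\
  (sin (angleA e b + angleB e b - angleP e b) =
     dpar e b * (e + 2) * (b + 2) / (c * q * r) /\
   cos (angleA e b + angleB e b - angleP e b) =
     (e + 2) * (b + 2) * (b - 2 + e) / (c * q * r)).
Proof.
  intros He Hb Heb.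
  assert (Hd := dpar_pos e b Heb).
  assert (Hdd := dpar_sqr e b Heb).
  set (d := dpar e b) in *.
  destruct (sin_cos_atan_div d e Hd) as [c [Hc [cA [sA _]]]].
  destruct (sin_cos_atan_div b d Hb) as [q [Hq [sB [cB _]]]].
  destruct (sin_cos_atan_div (e + b + 2) d) as [r [Hr [sP [cP _]]]]; [lra|].
  assert (sA' : sin (angleA e b) = d / c)
    by (unfold angleA; rewrite sin_shift; exact sA).
  assert (cA' : cos (angleA e b) = e / c)
    by (unfold angleA; rewrite cos_shift; exact cA).
  change (atan (d / b)) with (angleB e b) in *.
  change (atan (d / (e + b + 2))) with (angleP e b) in *.
  set (A := angleA e b) in *; set (B := angleB e b) in *; set (p := angleP e b) in *.
  assert (sBp : sin (B - p) = d * (e + 2) / (q * r)).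
  { rewrite sin_minus, sB, cB, sP, cP; field; lra. }
  assert (cBp : cos (B - p) = (e + 2) * (2 - e + b) / (q * r)).
  { rewrite cos_minus, sB, cB, sP, cP.
    replace (b / q * ((e + b + 2) / r) + d / q * (d / r)) with
      ((b * (e + b + 2) + d * d) / (q * r)) by (field; lra).
    rewrite Hdd; field; lra. }
  exists c, q, r; do 3 (split; [assumption|]).
  split; [now split|]; split; [now split|]; split; [now split|].
  split; split.
  - rewrite sin_minus, sA', cA', sP, cP; field; lra.
  - rewrite cos_minus, sA', cA', sP, cP.
    replace (e / c * ((e + b + 2) / r) + d / c * (d / r)) with
      ((e * (e + b + 2) + d * d) / (c * r)) by (field; lra).
    rewrite Hdd; field; lra.
  - replace (A + B - p) with (A + (B - p)) by ring.
    rewrite sin_plus, sA', cA', sBp, cBp; field; lra.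
  - replace (A + B - p) with (A + (B - p)) by ring.
    rewrite cos_plus, sA', cA', sBp, cBp.
    replace (e / c * ((e + 2) * (2 - e + b) / (q * r)) - d / c * (d * (e + 2) / (q * r)))
      with ((e + 2) * (e * (2 - e + b) - d * d) / (c * q * r)) by (field; lra).
    rewrite Hdd; field; lra.
Qed.

(** The two comparisons with [angleP] follow from the positivity of sin(A - 2p) and sin(B - p), both
    explicit quotients of positive factors. *)
Lemma angles_bounds (e b : R) :
  0 <= e -> 0 < b -> e ^ 2 + b ^ 2 < 4 ->
  0 < angleP e b /\ 2 * angleP e b < angleA e b <= PI / 2 /\
  angleP e b < angleB e b < PI / 2.
Proof.
  intros He Hb Heb.
  assert (Hd := dpar_pos e b Heb).
  destruct (angles_sin_cos e b He Hb Heb)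
    as [c [q [r [Hc [Hq [Hr [[sA cA] [[sBp _] [[sP cP] [[sAp cAp] _]]]]]]]]]].
  assert (BP : 0 < angleP e b < PI / 2)
    by (apply atan_bound_pos, Rdiv_lt_0_compat; lra).
  assert (BB : 0 < angleB e b < PI / 2)
    by (apply atan_bound_pos, Rdiv_lt_0_compat; lra).
  assert (BA : 0 < angleA e b <= PI / 2).
  { unfold angleA; generalize (atan_bound (e / dpar e b)).
    assert (0 <= atan (e / dpar e b)); [|lra].
    rewrite <- atan_0; apply Rge_le.
    destruct He as [He| <-].
    - left; apply atan_increasing, Rdiv_lt_0_compat; lra.
    - right; f_equal; field; lra. }
  repeat split; try lra.
  - assert (0 < angleA e b - angleP e b - angleP e b); [|lra].
    apply sin_pos_inv; [lra|].
    rewrite sin_minus, sAp, cAp, sP, cP.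
    replace (_ - _) with (2 * b * dpar e b * (b + 2) / (c * r * r)) by (field; lra).
    apply Rdiv_lt_0_compat; repeat apply Rmult_lt_0_compat; lra.
  - assert (0 < angleB e b - angleP e b); [|lra].
    apply sin_pos_inv; [lra|]; rewrite sBp.
    apply Rdiv_lt_0_compat; repeat apply Rmult_lt_0_compat; lra.
Qed.

(** Every sine except the first is a linear factor in u times a positive constant over [rho];
    [sin t] contains no u and balances the degrees in the quotients. *)
Lemma theta_sin (e b w : R) :
  0 <= e -> 0 < b -> e ^ 2 + b ^ 2 < 4 -> 2 < w ->
  let u := w + root b w in
  let A := angleA e b in let B := angleB e b in let p := angleP e b in
  let t := theta e b w in
  exists c q r rho, 0 < c /\ 0 < q /\ 0 < r /\ 0 < rho /\
  sin t = dpar e b / rho /\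
  sin (A - t) = dpar e b * u / (c * rho) /\
  sin (p - t) = dpar e b * (u - b - 2) / (r * rho) /\
  sin (B - p + t) = dpar e b * (e + 2) * (u + b + 2) / (q * r * rho) /\
  sin (A - p - t) = dpar e b * (b + 2) * (u + b - 2) / (c * r * rho) /\
  sin (A + B - p - t) = dpar e b * (e + 2) * (b + 2) * (u + 2 - b) / (c * q * r * rho).
Proof.
  intros He Hb Heb Hw u A B p t.
  assert (Hs := root_pos b w Hb ltac:(lra)).
  destruct (angles_sin_cos e b He Hb Heb)
    as [c [q [r [Hc [Hq [Hr [[sA cA] [[sBp cBp] [[sP cP] [[sAp cAp] [sABp cABp]]]]]]]]]]].
  destruct (sin_cos_atan_div (u + e) (dpar e b)) as [rho [Hrho [sT [cT _]]]];
    [unfold u; lra|].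
  change (atan (dpar e b / (u + e))) with t in sT, cT.
  fold A in sA, cA, sAp, cAp, sABp, cABp.
  fold B in sBp, cBp, sABp, cABp.
  fold p in sBp, cBp, sP, cP, sAp, cAp, sABp, cABp.
  exists c, q, r, rho; do 4 (split; [assumption|]).
  split; [exact sT|].
  repeat split.
  - rewrite sin_minus, sA, cA, sT, cT; field; lra.
  - rewrite sin_minus, sP, cP, sT, cT; field; lra.
  - rewrite sin_plus, sBp, cBp, sT, cT; field; lra.
  - rewrite sin_minus, sAp, cAp, sT, cT; field; lra.
  - rewrite sin_minus, sABp, cABp, sT, cT; field; lra.
Qed.

Lemma theta_bounds (e b w : R) :
  0 <= e -> 0 < b -> e ^ 2 + b ^ 2 < 4 -> 2 < w ->
  0 < theta e b w < angleP e b.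
Proof.
  intros He Hb Heb Hw.
  assert (Hd := dpar_pos e b Heb).
  assert (Hs := root_gt b w Hb Hw).
  assert (Bt : 0 < theta e b w < PI / 2)
    by (apply atan_bound_pos, Rdiv_lt_0_compat; lra).
  assert (Hp := angles_bounds e b He Hb Heb).
  destruct (theta_sin e b w He Hb Heb Hw)
    as [c [q [r [rho [Hc [Hq [Hr [Hrho [_ [_ [Sp _]]]]]]]]]]].
  split; [lra|].
  assert (0 < angleP e b - theta e b w); [|lra].
  apply sin_pos_inv; [lra|]; rewrite Sp.
  apply Rdiv_lt_0_compat; repeat apply Rmult_lt_0_compat; lra.
Qed.

Lemma theta_2 (e b : R) : 0 < b -> theta e b 2 = angleP e b.
Proof.
  intros Hb; unfold theta, angleP, root.
  replace (2 ^ 2 + b ^ 2 - 4) with (b * b) by ring.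
  rewrite sqrt_square by lra; do 2 f_equal; ring.
Qed.

Lemma is_derive_theta (e b w : R) :
  0 <= e -> 0 < b -> e ^ 2 + b ^ 2 < 4 -> 2 <= w ->
  is_derive (theta e b) w (- dpar e b / (2 * root b w * (w + e))).
Proof.
  intros He Hb Heb Hw.
  assert (Hs := root_pos b w Hb Hw).
  assert (Hss := root_sqr b w Hw).
  assert (Hdd := dpar_sqr e b Heb).
  assert (Hpos : 0 < w ^ 2 + b ^ 2 - 4) by nra.
  unfold theta, root in *.
  auto_derive.
  - replace (w * (w * 1) + b * (b * 1) + - (4)) with (w ^ 2 + b ^ 2 - 4) by ring.
    repeat split; lra.
  - replace (w * (w * 1) + b * (b * 1) + - (4)) with (w ^ 2 + b ^ 2 - 4) by ring.
    set (s := sqrt (w ^ 2 + b ^ 2 - 4)) in *; set (d := dpar e b) in *.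
    assert (Hb2 : b ^ 2 = s * s - w ^ 2 + 4) by lra.
    assert (Hd2 : d * d = w ^ 2 - s * s - e ^ 2) by lra.
    (* The denominator of the arctangent's derivative becomes 2 (w + s) (w + e); its factor w + s
       cancels against (w + s)' = (w + s) / s. *)
    replace (1 + d * / (w + s + e) * (d * / (w + s + e) * 1)) with
      (((w + s + e) ^ 2 + d * d) / (w + s + e) ^ 2) by (field; lra).
    rewrite Hd2.
    replace ((w + s + e) ^ 2 + (w ^ 2 - s * s - e ^ 2)) with
      (2 * (w + s) * (w + e)) by ring.
    field; lra.
Qed.

Lemma continuous_theta (e b w : R) :
  0 <= e -> 0 < b -> e ^ 2 + b ^ 2 < 4 -> 2 <= w -> continuous (theta e b) w.
Proof.
  intros He Hb Heb Hw; apply @ex_derive_continuous.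
  eexists; apply is_derive_theta; assumption.
Qed.

(** * Inverse hyperbolic tangents as logarithms of sines *)

Definition artanh_arg1 (b w : R) : R := (w ^ 2 - 4 - 2 * b) / (w * root b w).
Definition artanh_arg2 (b w : R) : R := b / root b w.

(** With v = w - s, numerator and denominator are proportional to u^2 - (b + 2)^2 and (b + 2)^2 -
    v^2. Multiplying by u^2 removes v, because u v = (2 + b) (2 - b). *)
Lemma artanh_arg1_ratio (b w : R) :
  0 < b < 2 -> 2 < w -> let u := w + root b w in
  -1 < artanh_arg1 b w < 1 /\
  (1 + artanh_arg1 b w) / (1 - artanh_arg1 b w) =
  (u * u * (u - b - 2) * (u + b + 2)) / ((b + 2) * (b + 2) * (u + b - 2) * (u + 2 - b)).
Proof.
  intros Hb Hw u.
  assert (Hs := root_gt b w ltac:(lra) Hw).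
  assert (Hss := root_sqr b w ltac:(lra)).
  set (s := root b w) in *.
  assert (Hws : 0 < w * s) by (apply Rmult_lt_0_compat; lra).
  assert (Huv : u * (w - s) = (2 + b) * (2 - b)) by (unfold u; nra).
  assert (HN : 2 * (w * s + (w ^ 2 - 4 - 2 * b)) = (u - b - 2) * (u + b + 2))
    by (unfold u; nra).
  assert (HD : 2 * (w * s - (w ^ 2 - 4 - 2 * b)) = (b + 2) * (b + 2) - (w - s) * (w - s))
    by nra.
  assert (HDu : 2 * (w * s - (w ^ 2 - 4 - 2 * b)) * (u * u) =
                (b + 2) * (b + 2) * ((u + b - 2) * (u + 2 - b))).
  { rewrite HD.
    replace (((b + 2) * (b + 2) - (w - s) * (w - s)) * (u * u)) with
      ((b + 2) * (b + 2) * (u * u) - u * (w - s) * (u * (w - s))) by ring.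
    rewrite Huv; ring. }
  assert (Hu : b + 2 < u) by (unfold u; lra).
  assert (HN0 : 0 < w * s + (w ^ 2 - 4 - 2 * b)).
  { assert (0 < (u - b - 2) * (u + b + 2)) by (apply Rmult_lt_0_compat; lra). lra. }
  assert (HD0 : 0 < w * s - (w ^ 2 - 4 - 2 * b)).
  { apply Rmult_lt_reg_r with (2 * (u * u)).
    - repeat apply Rmult_lt_0_compat; lra.
    - rewrite Rmult_0_l.
      apply Rlt_le_trans with ((b + 2) * (b + 2) * ((u + b - 2) * (u + 2 - b))); [|lra].
      repeat apply Rmult_lt_0_compat; lra. }
  unfold artanh_arg1; fold s.
  set (n := w ^ 2 - 4 - 2 * b) in *.
  split; [split|].
  - apply Rmult_lt_reg_r with (w * s); [lra|].
    unfold Rdiv; rewrite Rmult_assoc, Rinv_l, Rmult_1_r by lra; lra.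
  - apply Rmult_lt_reg_r with (w * s); [lra|].
    unfold Rdiv; rewrite Rmult_assoc, Rinv_l, Rmult_1_r by lra; lra.
  - replace ((1 + n / (w * s)) / (1 - n / (w * s))) with
      ((2 * (w * s + n)) * (u * u) / ((2 * (w * s - n)) * (u * u))).
    + rewrite HDu, HN; field; lra.
    + field; repeat split; try lra.
Qed.

(** Since 2 u s = u^2 + b^2 - 4, the products 2 u (s + b) and 2 u (s - b) are (u + b)^2 - 4 and (u -
    b)^2 - 4. *)
Lemma artanh_arg2_ratio (b w : R) :
  0 < b < 2 -> 2 < w -> let u := w + root b w in
  -1 < artanh_arg2 b w < 1 /\
  (1 + artanh_arg2 b w) / (1 - artanh_arg2 b w) =
  ((u + b - 2) * (u + b + 2)) / ((u - b - 2) * (u + 2 - b)).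
Proof.
  intros Hb Hw u.
  assert (Hs := root_gt b w ltac:(lra) Hw).
  assert (Hss := root_sqr b w ltac:(lra)).
  unfold artanh_arg2; set (s := root b w) in *.
  assert (Hu : b + 2 < u) by (unfold u; lra).
  assert (HN : 2 * u * (s + b) = (u + b - 2) * (u + b + 2)) by (unfold u; nra).
  assert (HD : 2 * u * (s - b) = (u - b - 2) * (u + 2 - b)) by (unfold u; nra).
  split; [split|].
  - apply Rmult_lt_reg_r with s; [lra|].
    unfold Rdiv; rewrite Rmult_assoc, Rinv_l, Rmult_1_r by lra; lra.
  - apply Rmult_lt_reg_r with s; [lra|].
    unfold Rdiv; rewrite Rmult_assoc, Rinv_l, Rmult_1_r by lra; lra.
  - rewrite <- HN, <- HD; field; lra.
Qed.

Lemma theta_sin_pos (e b w : R) :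
  0 <= e -> 0 < b -> e ^ 2 + b ^ 2 < 4 -> 2 < w ->
  let A := angleA e b in let B := angleB e b in let p := angleP e b in
  let t := theta e b w in
  0 < sin t /\ 0 < sin (A - t) /\ 0 < sin (p - t) /\ 0 < sin (B - p + t) /\
  0 < sin (A - p - t) /\ 0 < sin (A + B - p - t).
Proof.
  intros He Hb Heb Hw A B p t.
  assert (Bt := theta_bounds e b w He Hb Heb Hw).
  assert (Bp := angles_bounds e b He Hb Heb).
  fold t in Bt; fold A B p in Bt, Bp.
  repeat split; apply sin_gt_0; lra.
Qed.

Lemma artanh_arg1_log_sin (e b w : R) :
  0 <= e -> 0 < b -> e ^ 2 + b ^ 2 < 4 -> 2 < w ->
  let A := angleA e b in let B := angleB e b in let p := angleP e b in
  let t := theta e b w in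
  2 * artanh (artanh_arg1 b w) =
  2 * ln (2 * sin (A - t)) + ln (2 * sin (p - t)) + ln (2 * sin (B - p + t))
  - 2 * ln (2 * sin t) - ln (2 * sin (A - p - t)) - ln (2 * sin (A + B - p - t)).
Proof.
  intros He Hb Heb Hw A B p t.
  assert (Hd := dpar_pos e b Heb).
  assert (Hs := root_gt b w ltac:(lra) Hw).
  assert (Hb2 : 0 < b < 2) by nra.
  destruct (artanh_arg1_ratio b w Hb2 Hw) as [Hx HR].
  assert (Hpos := theta_sin_pos e b w He Hb Heb Hw).
  destruct (theta_sin e b w He Hb Heb Hw)
    as [c [q [r [rho [Hc [Hq [Hr [Hrho [S0 [S1 [S2 [S3 [S4 S5]]]]]]]]]]]]].
  unfold artanh; set (x := artanh_arg1 b w) in *.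
  assert (Hy : 0 < (1 + x) / (1 - x)) by (apply Rdiv_lt_0_compat; lra).
  (* Four sines on each side: the factors 2, the hypotenuses, d and the constants e + 2 all cancel,
     so no additive constant survives in the logarithm. *)
  assert (E : (1 + x) / (1 - x) * ((2 * sin t) * (2 * sin t) * (2 * sin (A - p - t))
                * (2 * sin (A + B - p - t)))
              = (2 * sin (A - t)) * (2 * sin (A - t)) * (2 * sin (p - t))
                * (2 * sin (B - p + t))).
  { unfold A, B, p, t; rewrite HR, S0, S1, S2, S3, S4, S5; field; lra. }
  set (y := (1 + x) / (1 - x)) in *; clearbody y.
  assert (EL := f_equal ln E).
  cbv zeta in Hpos; fold A B p t in Hpos.
  rewrite !ln_mult in EL by (repeat apply Rmult_lt_0_compat; lra).
  rewrite !ln_mult by lra; lra.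
Qed.

Lemma artanh_arg2_log_sin (e b w : R) :
  0 <= e -> 0 < b -> e ^ 2 + b ^ 2 < 4 -> 2 < w ->
  let A := angleA e b in let B := angleB e b in let p := angleP e b in
  let t := theta e b w in
  2 * artanh (artanh_arg2 b w) =
  ln (2 * sin (A - p - t)) + ln (2 * sin (B - p + t)) - ln (2 * sin (p - t))
  - ln (2 * sin (A + B - p - t)).
Proof.
  intros He Hb Heb Hw A B p t.
  assert (Hd := dpar_pos e b Heb).
  assert (Hs := root_gt b w ltac:(lra) Hw).
  assert (Hb2 : 0 < b < 2) by nra.
  destruct (artanh_arg2_ratio b w Hb2 Hw) as [Hx HR].
  assert (Hpos := theta_sin_pos e b w He Hb Heb Hw).
  destruct (theta_sin e b w He Hb Heb Hw)
    as [c [q [r [rho [Hc [Hq [Hr [Hrho [S0 [S1 [S2 [S3 [S4 S5]]]]]]]]]]]]].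
  unfold artanh; set (x := artanh_arg2 b w) in *.
  assert (Hy : 0 < (1 + x) / (1 - x)) by (apply Rdiv_lt_0_compat; lra).
  assert (E : (1 + x) / (1 - x) * ((2 * sin (p - t)) * (2 * sin (A + B - p - t)))
              = (2 * sin (A - p - t)) * (2 * sin (B - p + t))).
  { unfold A, B, p, t; rewrite HR, S2, S3, S4, S5; field; lra. }
  set (y := (1 + x) / (1 - x)) in *; clearbody y.
  assert (EL := f_equal ln E).
  cbv zeta in Hpos; fold A B p t in Hpos.
  rewrite !ln_mult in EL by (repeat apply Rmult_lt_0_compat; lra).
  rewrite !ln_mult by lra; lra.
Qed.

Definition kernel1 (e b w : R) : R := / (root b w * (w + e)) * artanh (artanh_arg1 b w).
Definition kernel2 (e b w : R) : R := / (root b w * (w + e)) * artanh (artanh_arg2 b w).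

Lemma ex_derive_artanh (x : R) : -1 < x < 1 -> ex_derive artanh x.
Proof.
  intros Hx; unfold artanh; auto_derive.
  assert (0 < (1 + x) / (1 - x)) by (apply Rdiv_lt_0_compat; lra).
  split; [lra|]; split; [assumption|easy].
Qed.

Lemma ex_derive_root (b w : R) : 0 < b -> 2 <= w -> ex_derive (root b) w.
Proof.
  intros Hb Hw; assert (0 < w ^ 2 + b ^ 2 - 4) by nra.
  unfold root; auto_derive; simpl in *; lra.
Qed.

Lemma continuous_weight (e b w : R) :
  0 <= e -> 0 < b -> 2 < w -> continuous (fun w => / (root b w * (w + e))) w.
Proof.
  intros He Hb Hw; apply @ex_derive_continuous.
  assert (Hs := root_pos b w Hb ltac:(lra)).
  assert (Dr := ex_derive_root b w Hb ltac:(lra)).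
  auto_derive; repeat split; [exact Dr|].
  apply Rgt_not_eq, Rmult_lt_0_compat; lra.
Qed.

Lemma continuous_kernel1 (e b w : R) :
  0 <= e -> 0 < b < 2 -> 2 < w -> continuous (kernel1 e b) w.
Proof.
  intros He Hb Hw; unfold kernel1.
  apply @continuous_mult; [apply continuous_weight; lra|].
  apply (continuous_comp (artanh_arg1 b) artanh); apply @ex_derive_continuous.
  - assert (Hs := root_pos b w ltac:(lra) ltac:(lra)).
    assert (Dr := ex_derive_root b w ltac:(lra) ltac:(lra)).
    unfold artanh_arg1; auto_derive; repeat split; [exact Dr|].
    apply Rgt_not_eq, Rmult_lt_0_compat; lra.
  - apply ex_derive_artanh, artanh_arg1_ratio; lra.
Qed.

Lemma continuous_kernel2 (e b w : R) :
  0 <= e -> 0 < b < 2 -> 2 < w -> continuous (kernel2 e b) w.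
Proof.
  intros He Hb Hw; unfold kernel2.
  apply @continuous_mult; [apply continuous_weight; lra|].
  apply (continuous_comp (artanh_arg2 b) artanh); apply @ex_derive_continuous.
  - assert (Hs := root_pos b w ltac:(lra) ltac:(lra)).
    assert (Dr := ex_derive_root b w ltac:(lra) ltac:(lra)).
    unfold artanh_arg2; auto_derive; repeat split; [exact Dr|lra].
  - apply ex_derive_artanh, artanh_arg2_ratio; lra.
Qed.

Lemma is_derive_kernel1 (e b w : R) :
  0 <= e -> 0 < b -> e ^ 2 + b ^ 2 < 4 -> 2 < w ->
  is_derive (fun w => - / dpar e b *
    primitive1 (angleA e b) (angleB e b) (angleP e b) (theta e b w)) w (kernel1 e b w).
Proof.
  intros He Hb Heb Hw.
  assert (Hd := dpar_pos e b Heb).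
  assert (Hs := root_pos b w Hb ltac:(lra)).
  destruct (angles_bounds e b He Hb Heb) as [Bp [BA BB]].
  evar_last.
  - apply @is_derive_scal, (is_derive_comp (primitive1 _ _ _) (theta e b)).
    + apply is_derive_primitive1; [apply theta_bounds|..]; assumption.
    + apply is_derive_theta; [..|lra]; assumption.
  - rewrite <- artanh_arg1_log_sin by assumption.
    unfold kernel1, scal; simpl; unfold mult; simpl; field; lra.
Qed.

Lemma is_derive_kernel2 (e b w : R) :
  0 <= e -> 0 < b -> e ^ 2 + b ^ 2 < 4 -> 2 < w ->
  is_derive (fun w => - / dpar e b *
    primitive2 (angleA e b) (angleB e b) (angleP e b) (theta e b w)) w (kernel2 e b w).
Proof.
  intros He Hb Heb Hw.
  assert (Hd := dpar_pos e b Heb).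
  assert (Hs := root_pos b w Hb ltac:(lra)).
  destruct (angles_bounds e b He Hb Heb) as [Bp [BA BB]].
  assert (Bt := theta_bounds e b w He Hb Heb Hw).
  evar_last.
  - apply @is_derive_scal, (is_derive_comp (primitive2 _ _ _) (theta e b)).
    + apply is_derive_primitive2; [lra|..]; assumption.
    + apply is_derive_theta; [..|lra]; assumption.
  - rewrite <- artanh_arg2_log_sin by assumption.
    unfold kernel2, scal; simpl; unfold mult; simpl; field; lra.
Qed.

(** * The improper integrals *)

(** [F] needs only limits along the two filters, so one statement covers the logarithmic endpoint 2,
    the splitting point and infinity. Once both bounds exceed [m], so does the segment between
    them. *)
Lemma is_RInt_gen_primitive {Fa Fb : (R -> Prop) -> Prop} {FFa : Filter Fa}
    {FFb : Filter Fb} (f F : R -> R) (m la lb : R) :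
  (forall x, m < x -> is_derive F x (f x)) ->
  (forall x, m < x -> continuous f x) ->
  Fa (fun x => m < x) -> Fb (fun x => m < x) ->
  filterlim F Fa (locally la) -> filterlim F Fb (locally lb) ->
  is_RInt_gen f Fa Fb (lb - la).
Proof.
  intros DF Cf Ha Hb La Lb.
  assert (Hab : forall P : R -> Prop, (forall x, m < x -> P x) ->
    filter_prod Fa Fb (fun ab => forall x, Rmin (fst ab) (snd ab) <= x <= Rmax (fst ab) (snd ab) -> P x)).
  { intros P HP; apply (Filter_prod _ _ _ (fun x => m < x) (fun x => m < x) Ha Hb).
    intros x y Hx Hy z Hz; apply HP.
    simpl in Hz; assert (m < Rmin x y) by (apply Rmin_glb_lt; assumption); lra. }
  assert (HD : forall x, m < x -> Derive F x = f x)
    by (intros x Hx; apply is_derive_unique, DF, Hx).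
  apply (is_RInt_gen_ext (Derive F)).
  - eapply filter_imp; [|exact (Hab _ HD)].
    intros ab H x Hx; apply H; lra.
  - apply is_RInt_gen_Derive; [..|exact La|exact Lb].
    + apply Hab; intros x Hx; exists (f x); apply DF, Hx.
    + apply Hab; intros x Hx.
      apply (continuous_ext_loc (Derive F) f x); [|apply Cf, Hx].
      apply (filter_imp (fun y => m < y)); [intros y Hy; symmetry; apply HD, Hy|].
      apply open_gt, Hx.
Qed.

Lemma at_right_gt (x : R) : at_right x (fun y => x < y).
Proof. exists posreal_one; intros y _ Hy; exact Hy. Qed.

Lemma filterlim_theta_p_infty (e b : R) :
  0 <= e -> 0 < b -> e ^ 2 + b ^ 2 < 4 ->
  filterlim (theta e b) (Rbar_locally p_infty) (locally 0).
Proof.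
  intros He Hb Heb; unfold theta.
  assert (Hd := dpar_pos e b Heb).
  apply (filterlim_comp _ _ _ (fun w => dpar e b / (w + root b w + e)) atan _ (locally 0)).
  - apply filterlim_locally; intros eps.
    exists (Rmax 2 (dpar e b / eps)); intros w Hw.
    generalize (Rmax_l 2 (dpar e b / eps)) (Rmax_r 2 (dpar e b / eps)); intros M1 M2.
    assert (Hs := root_pos b w Hb ltac:(lra)).
    assert (Heps := cond_pos eps).
    assert (Hdw : dpar e b < w * eps).
    { apply Rmult_lt_reg_r with (/ eps); [apply Rinv_0_lt_compat, Heps|].
      rewrite Rmult_assoc, Rinv_r by lra; unfold Rdiv in *; lra. }
    change (Rabs (dpar e b / (w + root b w + e) - 0) < eps).
    rewrite Rminus_0_r, Rabs_pos_eq by (left; apply Rdiv_lt_0_compat; lra).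
    apply Rmult_lt_reg_r with (w + root b w + e); [lra|].
    unfold Rdiv; rewrite Rmult_assoc, Rinv_l, Rmult_1_r by lra; nra.
  - rewrite <- atan_0 at 2.
    apply continuity_pt_filterlim, derivable_continuous_pt, derivable_pt_atan.
Qed.

Lemma is_RInt_gen_kernel1 (e b : R) :
  0 <= e -> 0 < b -> e ^ 2 + b ^ 2 < 4 ->
  let P := primitive1 (angleA e b) (angleB e b) (angleP e b) in
  is_RInt_gen (kernel1 e b) (at_right 2) (at_point (2 + b))
    (/ dpar e b * (P (angleP e b) - P (theta e b (2 + b)))).
Proof.
  intros He Hb Heb P.
  destruct (angles_bounds e b He Hb Heb) as [Bp [BA BB]].
  replace (/ dpar e b * (P (angleP e b) - P (theta e b (2 + b)))) with
    (- / dpar e b * P (theta e b (2 + b)) - (- / dpar e b * P (angleP e b))) by ring.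
  (* The primitive stays continuous through w = 2 although its derivative is singular there; this
     supplies the limit along [at_right 2]. *)
  assert (C2 : continuous (fun w => - / dpar e b * P (theta e b w)) 2).
  { apply @continuous_scal_r, (continuous_comp (theta e b) P).
    - apply continuous_theta; lra.
    - rewrite theta_2 by assumption; apply continuous_primitive1; lra. }
  apply (is_RInt_gen_primitive _ (fun w => - / dpar e b * P (theta e b w)) 2).
  - intros w Hw; apply is_derive_kernel1; assumption.
  - intros w Hw; apply continuous_kernel1; [assumption|nra|assumption].
  - apply at_right_gt.
  - unfold at_point; lra.
  - rewrite <- (theta_2 e b Hb).
    intros Q HQ; unfold filtermap, at_right, within.
    eapply filter_imp; [|exact (C2 Q HQ)]; intros y Hy _; exact Hy.
  - intros Q HQ; exact (locally_singleton _ _ HQ).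
Qed.

Lemma is_RInt_gen_kernel2 (e b : R) :
  0 <= e -> 0 < b -> e ^ 2 + b ^ 2 < 4 ->
  let P := primitive2 (angleA e b) (angleB e b) (angleP e b) in
  is_RInt_gen (kernel2 e b) (at_point (2 + b)) (Rbar_locally p_infty)
    (/ dpar e b * (P (theta e b (2 + b)) - P 0)).
Proof.
  intros He Hb Heb P.
  destruct (angles_bounds e b He Hb Heb) as [Bp [BA BB]].
  replace (/ dpar e b * (P (theta e b (2 + b)) - P 0)) with
    (- / dpar e b * P 0 - (- / dpar e b * P (theta e b (2 + b)))) by ring.
  apply (is_RInt_gen_primitive _ (fun w => - / dpar e b * P (theta e b w)) 2).
  - intros w Hw; apply is_derive_kernel2; assumption.
  - intros w Hw; apply continuous_kernel2; [assumption|nra|assumption].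
  - unfold at_point; lra.
  - exists 2; easy.
  - intros Q HQ; exact (locally_singleton _ _ HQ).
  - apply (filterlim_comp _ _ _ (theta e b) (fun t => - / dpar e b * P t) _ (locally 0)).
    + apply filterlim_theta_p_infty; assumption.
    + apply @continuous_scal_r, @ex_derive_continuous.
      eexists; apply is_derive_primitive2; [lra|assumption|assumption].
Qed.

(* At [w = 2 + b] the two arguments of [artanh] agree; in the angular variable
   this is the hypothesis of [Cl2_identity]. *)
Lemma theta_2b_relation (e b : R) :
  0 <= e -> 0 < b -> e ^ 2 + b ^ 2 < 4 ->
  cos (angleA e b - 2 * theta e b (2 + b)) * cos (angleP e b)
  = cos (angleA e b - angleP e b).
Proof.
  intros He Hb Heb.
  destruct (theta_sin e b (2 + b) He Hb Heb ltac:(lra))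
    as [c [q [r [rho [Hc [Hq [Hr [Hrho [S0 [S1 [S2 [_ [S4 _]]]]]]]]]]]]].
  assert (Hss := root_sqr b (2 + b) ltac:(lra)).
  set (A := angleA e b) in *; set (p := angleP e b) in *.
  set (t := theta e b (2 + b)) in *; set (s := root b (2 + b)) in *.
  assert (E : sin (A - t) * sin (p - t) = sin t * sin (A - p - t)).
  { rewrite S0, S1, S2, S4.
    replace (dpar e b * (2 + b + s) / (c * rho) *
             (dpar e b * (2 + b + s - b - 2) / (r * rho))) with
      (dpar e b * dpar e b * ((2 + b) * s + s * s) / (c * r * rho * rho)) by (field; lra).
    rewrite Hss; field; lra. }
  generalize (two_sin_sin (A - t) (p - t)) (two_sin_sin t (A - p - t)).
  replace (A - t - (p - t)) with (A - p) by ring.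
  replace (A - t + (p - t)) with (A - 2 * t + p) by ring.
  replace (t - (A - p - t)) with (- (A - 2 * t - p)) by ring.
  replace (t + (A - p - t)) with (A - p) by ring.
  rewrite cos_neg, cos_plus, (cos_minus (A - 2 * t) p); lra.
Qed.

(** At e = 0, d^2 + b^2 = 4, so tan p = d / (b + 2) is the half-angle formula and B = 2p, while A =
    PI / 2. The eight terms then cancel in pairs, with Cl2(PI + 2p) = -Cl2(PI - 2p) and Cl2(PI) =
    0. *)
Lemma Cl2_sum_0 (b : R) :
  0 < b -> b ^ 2 < 4 -> Cl2_sum (angleA 0 b) (angleB 0 b) (angleP 0 b) = 0.
Proof.
  intros Hb Hb2.
  assert (Heb : 0 ^ 2 + b ^ 2 < 4) by lra.
  assert (Hd := dpar_pos 0 b Heb).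
  destruct (angles_bounds 0 b ltac:(lra) Hb Heb) as [Bp [BA BB]].
  destruct (angles_sin_cos 0 b ltac:(lra) Hb Heb)
    as [c [q [r [Hc [Hq [Hr [_ [[sBp cBp] [[sP cP] _]]]]]]]]].
  assert (EA : angleA 0 b = PI / 2).
  { unfold angleA, Rdiv; rewrite Rmult_0_l, atan_0; ring. }
  assert (EB : angleB 0 b = 2 * angleP 0 b).
  { set (x := angleB 0 b - angleP 0 b - angleP 0 b).
    assert (Hx : sin x = 0).
    { unfold x; rewrite sin_minus, sBp, cBp, sP, cP; field; lra. }
    assert (Hxb : - PI < x < PI) by (unfold x; lra).
    assert (x = 0); [|unfold x in *; lra].
    destruct (Rtotal_order x 0) as [H|[H|H]]; [|exact H|].
    - generalize (sin_gt_0 (- x)); rewrite sin_neg; lra.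
    - generalize (sin_gt_0 x); lra. }
  rewrite EB, EA; unfold Cl2_sum; set (p := angleP 0 b).
  replace (2 * (PI / 2) + 2 * (2 * p) - 2 * p) with (2 * PI - (PI - 2 * p)) by field.
  replace (2 * (PI / 2) + 2 * (2 * p) - 4 * p) with PI by field.
  replace (2 * (PI / 2) - 2 * p) with (PI - 2 * p) by field.
  replace (2 * (PI / 2)) with PI by field.
  replace (2 * (2 * p) - 2 * p) with (2 * p) by ring.
  replace (2 * (2 * p)) with (4 * p) by ring.
  rewrite Cl2_2PI_minus, Cl2_PI; ring.
Qed.

Lemma is_RInt_gen_partial_fraction {Fa Fb : (R -> Prop) -> Prop} {FFa : Filter Fa}
    {FFb : Filter Fb} (a : R) (f k0 ka : R -> R) (l0 la : R) :
  (forall w, 2 < w -> f w = / a * (k0 w - ka w)) ->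
  Fa (fun x => 2 < x) -> Fb (fun x => 2 < x) ->
  is_RInt_gen k0 Fa Fb l0 -> is_RInt_gen ka Fa Fb la ->
  is_RInt_gen f Fa Fb (/ a * (l0 - la)).
Proof.
  intros Hf Ha Hb H0 H1.
  apply (is_RInt_gen_ext (fun w => scal (/ a) (minus (k0 w) (ka w)))).
  - apply (Filter_prod _ _ _ (fun x => 2 < x) (fun x => 2 < x) Ha Hb).
    intros x y Hx Hy z Hz; symmetry; apply Hf.
    simpl in Hz; assert (2 < Rmin x y) by (apply Rmin_glb_lt; assumption); lra.
  - apply (is_RInt_gen_scal (fun w => minus (k0 w) (ka w)) (/ a) (minus l0 la)).
    apply (is_RInt_gen_minus k0 ka l0 la); assumption.
Qed.

Theorem mainTheorem4 (a b : R) (ha : 0 < a) (hb : 0 < b)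
    (hab : a ^ 2 + b ^ 2 < 4) :
  let d := sqrt (4 - a ^ 2 - b ^ 2) in
  let phi := atan (d / (a + b + 2)) in
  let phia := atan (d / a) in
  let phib := atan (d / b) in
  ex_RInt_gen (integrand1 a b) (at_right 2) (at_point (2 + b)) /\
  ex_RInt_gen (integrand2 a b) (at_point (2 + b)) (Rbar_locally p_infty) /\
  Cfun a b =
    8 / (a * b * sqrt (4 - a ^ 2 - b ^ 2)) *
    (Cl2 (4 * phi) + Cl2 (2 * phia + 2 * phib - 2 * phi)
     + Cl2 (2 * phia - 2 * phi) + Cl2 (2 * phib - 2 * phi)
     - Cl2 (2 * phia + 2 * phib - 4 * phi)
     - Cl2 (2 * phia) - Cl2 (2 * phib) - Cl2 (2 * phi)).
Proof.
  intros d phi phia phib.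
  assert (h0 : 0 ^ 2 + b ^ 2 < 4) by nra.
  assert (Hd : 0 < d) by (apply dpar_pos; assumption).
  assert (Hd0 := dpar_pos 0 b h0).
  assert (EA : phia = angleA a b).
  { unfold phia, angleA.
    replace (d / a) with (/ (a / d)) by (field; lra).
    apply atan_inv, Rdiv_lt_0_compat; assumption. }
  (* Taken alone, each integral is expressed with Clausen values at [theta e b (2 + b)]; these
     disappear only from the sum. *)
  assert (Hsum : forall e, 0 <= e -> e ^ 2 + b ^ 2 < 4 -> exists l1 l2,
    is_RInt_gen (kernel1 e b) (at_right 2) (at_point (2 + b)) l1 /\
    is_RInt_gen (kernel2 e b) (at_point (2 + b)) (Rbar_locally p_infty) l2 /\
    l1 + l2 = / (2 * dpar e b) * Cl2_sum (angleA e b) (angleB e b) (angleP e b)).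
  { intros e He Heb; do 2 eexists.
    split; [apply is_RInt_gen_kernel1; assumption|].
    split; [apply is_RInt_gen_kernel2; assumption|].
    assert (Hde := dpar_pos e b Heb).
    rewrite <- Rmult_plus_distr_l.
    rewrite primitives_Cl2_sum.
    - field; lra.
    - apply theta_bounds; lra.
    - apply angles_bounds; assumption.
    - apply theta_2b_relation; assumption. }
  destruct (Hsum 0 ltac:(lra) h0) as [l1 [l2 [I1 [I2 E0]]]].
  destruct (Hsum a ltac:(lra) hab) as [m1 [m2 [J1 [J2 Ea]]]].
  rewrite Cl2_sum_0, Rmult_0_r in E0 by nra.
  assert (K1 : is_RInt_gen (integrand1 a b) (at_right 2) (at_point (2 + b)) (/ a * (l1 - m1))).
  { apply (is_RInt_gen_partial_fraction a _ (kernel1 0 b) (kernel1 a b));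
      [|apply at_right_gt|unfold at_point; lra|assumption|assumption].
    intros w Hw; unfold integrand1, kernel1.
    change (sqrt (w ^ 2 + b ^ 2 - 4)) with (root b w).
    fold (artanh_arg1 b w).
    assert (Hs := root_pos b w hb ltac:(lra)); field; lra. }
  assert (K2 : is_RInt_gen (integrand2 a b) (at_point (2 + b)) (Rbar_locally p_infty)
                 (/ a * (l2 - m2))).
  { apply (is_RInt_gen_partial_fraction a _ (kernel2 0 b) (kernel2 a b));
      [|unfold at_point; lra|exists 2; easy|assumption|assumption].
    intros w Hw; unfold integrand2, kernel2.
    change (sqrt (w ^ 2 + b ^ 2 - 4)) with (root b w).
    fold (artanh_arg2 b w).
    assert (Hs := root_pos b w hb ltac:(lra)); field; lra. }
  split; [eexists; exact K1|]; split; [eexists; exact K2|].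
  unfold Cfun.
  rewrite (is_RInt_gen_unique _ _ K1), (is_RInt_gen_unique _ _ K2).
  change (sqrt (4 - a ^ 2 - b ^ 2)) with d.
  rewrite EA.
  match goal with |- _ = _ * ?T =>
    change T with (Cl2_sum (angleA a b) (angleB a b) (angleP a b)) end.
  change (dpar a b) with d in Ea.
  replace (Cl2_sum _ _ _) with (2 * d * (m1 + m2)) by (rewrite Ea; field; lra).
  (* [E0] says only that the two integrals at e = 0 have sum zero; this is enough because both
     halves of [Cfun] carry the same factor. *)
  replace l1 with (- l2) by lra.
  field; lra.
Qed.
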